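(* Let $n\geqslant 2$. For each $i\in\{1,\ldots,n-1\}$, let $r_i\in\{0,1\}$ and set $r=r_1+\cdots+r_{n-1}$. Then, for any integers $m_1,\ldots,m_{n-1}\geqslant 0$, we have $$\eta(2m_1+r_1,\ldots,2m_{n-1}+r_{n-1})=\frac{(-1)^r}{2}\Bigl(\eta(m_1,\ldots,m_{n-1})+(-1)^n\,\eta(m_1+r_1,\ldots,m_{n-1}+r_{n-1})\Bigr).$$
   Context: The Thue--Morse sequence $(t_k)_{k\geqslant 0}$ with values $\pm1$ is defined by $t_0=1$, $t_{2k}=t_k$, $t_{2k+1}=-t_k$ for $k\geqslant 0$. Its bi-infinite extension is $w=(w_n)_{n\in\mathbb{Z}}$ with $w_n=t_n$ for $n\geqslant 0$ and $w_n=t_{-n-1}$ for $n<0$. Let $(Sx)_i=x_{i+1}$ be the shift on $\{\pm1\}^{\mathbb{Z}}$ and let $\mathbb{X}=\overline{\{S^iw:i\in\mathbb{Z}\}}\subset\{\pm1\}^{\mathbb{Z}}$ (closure in the product topology). It is a known fact that $(\mathbb{X},\mathbb{Z})$ is strictly ergodic (minimal and uniquely ergodic); $\mu$ denotes its unique shift-invariant probability measure. The (balanced) $n$-point correlations are $$\eta(m_1,\ldots,m_{n-1})=\int_{\mathbb{X}}x_0\,x_{m_1}\cdots x_{m_{n-1}}\,\mathrm{d}\mu(x)=\lim_{N\to\infty}\frac1N\sum_{k=0}^{N-1}t_kt_{k+m_1}\cdots t_{k+m_{n-1}},\qquad m_i\in\mathbb{N}_0,$$ where the limit is known to exist by Birkhoff's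 ergodic theorem for uniquely ergodic systems. *)

(* Defs.v *)
From HB Require Import structures.
From mathcomp Require Import all_boot all_order all_algebra.
From mathcomp Require Import all_classical all_reals all_analysis.

Set Implicit Arguments.
Unset Strict Implicit.
Unset Printing Implicit Defensive.

Import Order.TTheory GRing.Theory Num.Theory.
Import numFieldNormedType.Exports.

Local Open Scope classical_set_scope.
Local Open Scope ring_scope.

(* The alphabet {1, -1} is [bool] (a discrete space), where [b] stands for
   [(-1) ^+ b]; hence [~~ b] stands for the opposite of the letter [b]. *)
Definition letter {R : realType} (b : bool) : R := (-1) ^+ b.

(* [thue_morse_rec f k] is [t_k] as soon as the fuel satisfies [k <= f]; the
   recursion reads t_k off t_(k./2), see [thue_morse_double] and
   [thue_morse_doubleS]. *)
Fixpoint thue_morse_rec (f k : nat) : bool :=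
  if f is f'.+1 then
    if k == 0%N then false
    else if odd k then ~~ thue_morse_rec f' k./2 else thue_morse_rec f' k./2
  else false.

Definition thue_morse (k : nat) : bool := thue_morse_rec k k.

Lemma thue_morse_rec_fuel (f k : nat) :
  (k <= f)%N -> thue_morse_rec f k = thue_morse k.
Proof.
rewrite /thue_morse.
suff H f1 : forall f2 j, (j <= f1)%N -> (j <= f2)%N ->
    thue_morse_rec f1 j = thue_morse_rec f2 j by move=> kf; apply: H.
elim: f1 => [|f1 IH] [|f2] [|j] //= j1 j2.
have hj : (uphalf j <= j)%N by rewrite leq_uphalf_double -addnn leq_addr.
by rewrite (IH f2) // (leq_trans hj).
Qed.

Lemma thue_morse0 : thue_morse 0 = false.
Proof. by []. Qed.

Lemma thue_morse_double (k : nat) : thue_morse k.*2 = thue_morse k.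
Proof.
case: k => // k; rewrite {1}/thue_morse.
have -> : thue_morse_rec k.+1.*2 k.+1.*2 = thue_morse_rec k.*2.+1 k.+1.
  by rewrite doubleS /= odd_double /= doubleK.
by rewrite thue_morse_rec_fuel // ltnS -addnn leq_addr.
Qed.

Lemma thue_morse_doubleS (k : nat) : thue_morse k.*2.+1 = ~~ thue_morse k.
Proof.
rewrite {1}/thue_morse /= odd_double /= uphalf_double.
by rewrite thue_morse_rec_fuel // -addnn leq_addr.
Qed.

Definition full_shift : Type := prod_topology (fun _ : int => bool).

HB.instance Definition _ := Pointed.on full_shift.
HB.instance Definition _ := Topological.on full_shift.

(* [Negz k] is the integer - k - 1, so the second branch is t_(- n - 1). *)
Definition bi_thue_morse : full_shift :=
  fun n : int => match n with Posz k => thue_morse k | Negz k => thue_morse k end.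

(* [shift_by i] is the [i]-th iterate of the shift S = [shift_by 1]. *)
Definition shift_by (i : int) (x : full_shift) : full_shift :=
  fun j : int => x (j + i).

Definition TM_hull : set full_shift :=
  closure (range (fun i : int => shift_by i bi_thue_morse)).

(* [full_shift] with its Borel sigma-algebra. *)
Definition borel_full_shift : measurableType _ :=
  g_sigma_algebraType (@open full_shift).

(* Shift-invariant Borel probability measures on the hull, seen as measures on
   the full shift carried by the hull. By unique ergodicity of the Thue-Morse
   system there is exactly one. *)
Definition TM_invariant {R : realType} (mu : probability borel_full_shift R) :=
  mu TM_hull = 1%E /\
  forall A : set borel_full_shift,
    measurable A -> mu (shift_by 1 @^-1` A) = mu A.

(* The (k + 1)-point correlation eta(m_1, ..., m_k). *)
Definition eta {R : realType} (mu : probability borel_full_shift R)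
    (k : nat) (m : 'I_k -> nat) : R :=
  \int[mu]_(x in TM_hull)
    (letter (x 0) * \prod_(i < k) letter (x (Posz (m i)))).

(* Main.v *)
Require Import Defs.
From mathcomp Require Import all_boot all_order all_algebra.
From mathcomp Require Import all_classical all_reals all_analysis.
From mathcomp Require Import measurable_realfun zify ring lra.

(** The sums B_p(a) of t_k t_(k+m_1) ... t_(k+m_(n-1)) over the dyadic blocks
    a 2^p <= k < (a+1) 2^p, p > 0, differ from B_p(0) by at most a constant that
    does not depend on p or a. Every finite window of a point of the hull occurs
    in t, so the Birkhoff sums of x_0 x_(m_1) ... x_(m_(n-1)) along q 2^p shifts
    are q (B_p(0) + O(1)) + O(2^p) uniformly on the hull; integrating against the
    invariant measure and letting q go to infinity gives
    2^p eta = B_p(0) + O(1). Splitting k into even and odd makes the announced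
    recursion exact for the sums B_p(0); dividing by 2^p, with p arbitrarily
    large, transfers it to eta. *)

Set Implicit Arguments.
Unset Strict Implicit.
Unset Printing Implicit Defensive.
Import Order.TTheory GRing.Theory Num.Theory.
Import numFieldNormedType.Exports.
Local Open Scope classical_set_scope.
Local Open Scope ring_scope.

(** * Dyadic blocks of the Thue-Morse sequence and finite windows of the hull *)

(** [t] is the parity of the binary digit sum, and the digits of [a * 2 ^ p + j] are those of [a]
    followed by [p] digits for [j]. *)
Lemma thue_morse_block (p a j : nat) : (j < 2 ^ p)%N ->
  thue_morse (a * 2 ^ p + j) = thue_morse a (+) thue_morse j.
Proof.
elim: p j => [|p IH] j jp.
  by move: jp; rewrite ltnS leqn0 => /eqP ->; rewrite muln1 addn0 addbF.
rewrite -(odd_double_half j).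
have hp : (j./2 < 2 ^ p)%N by move: jp; rewrite expnS; lia.
have -> : (a * 2 ^ p.+1 + (odd j + j./2.*2) =
           odd j + (a * 2 ^ p + j./2).*2)%N by rewrite expnS; lia.
by case: (odd j); rewrite ?add1n ?add0n ?thue_morse_doubleS ?thue_morse_double IH //
  ?addbN.
Qed.

(** Passing from [j] to [2 ^ p - 1 - j] complements [p] binary digits, so the two digit sums add up
    to [p]. *)
Lemma thue_morse_rev (p j : nat) : (j < 2 ^ p)%N ->
  thue_morse (2 ^ p - j.+1) = odd p (+) thue_morse j.
Proof.
elim: p j => [|p IH] j jp; first by move: jp; rewrite ltnS leqn0 => /eqP ->.
have hp : (j./2 < 2 ^ p)%N by move: jp; rewrite expnS; lia.
have := odd_double_half j; case: (odd j) => /= <-; rewrite ?add1n ?add0n.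
  have -> : (2 ^ p.+1 - j./2.*2.+2 = (2 ^ p - j./2.+1).*2)%N
    by rewrite expnS; lia.
  by rewrite thue_morse_double thue_morse_doubleS IH // addNb addbN negbK.
have -> : (2 ^ p.+1 - j./2.*2.+1 = (2 ^ p - j./2.+1).*2.+1)%N
  by rewrite expnS; lia.
by rewrite thue_morse_doubleS thue_morse_double IH // addNb.
Qed.

(* [5 = 101] and [6 = 110] in binary are consecutive with [t = 1], so the
   palindromic block of length [4 ^ p] is repeated around [6 * 4 ^ p]. *)
Lemma bi_thue_morse_nat (p : nat) (l : int) : (`|l| < 2 ^ p.*2)%N ->
  exists2 a : nat, Posz a = l + Posz (6 * 2 ^ p.*2)%N
    & bi_thue_morse l = thue_morse a.
Proof.
case: l => k kp.
  exists (6 * 2 ^ p.*2 + k)%N; first by lia.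
  by rewrite thue_morse_block.
exists (5 * 2 ^ p.*2 + (2 ^ p.*2 - k.+1))%N; first by lia.
rewrite thue_morse_block; last by lia.
by rewrite thue_morse_rev ?odd_double //=; lia.
Qed.

Lemma bi_thue_morse_factor (K : nat) (i : int) : exists a : nat,
  forall j : nat, (j < K)%N -> bi_thue_morse (Posz j + i) = thue_morse (a + j).
Proof.
(* This [p] puts the whole window [i, ..., i + K - 1] inside the range [|l| < 4 ^ p] that is
   repeated around [6 * 4 ^ p]. *)
pose p := (`|i| + K)%N.
have pP : (p < 2 ^ p.*2)%N.
  by rewrite (leq_trans (ltn_expl p (isT : 1 < 2)%N)) // leq_exp2l // -addnn leq_addr.
exists `|(i + Posz (6 * 2 ^ p.*2)%N)%R|%N => j jK.
have [|a ea ->] := @bi_thue_morse_nat p (Posz j + i); first by lia.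
by congr thue_morse; lia.
Qed.

(** The points agreeing with [x] on finitely many coordinates form a neighbourhood of [x], which the
    orbit of [w] must meet. *)
Lemma TM_hull_factor (x : full_shift) (K : nat) : TM_hull x ->
  exists a : nat, forall j : nat, (j < K)%N -> x (Posz j) = thue_morse (a + j).
Proof.
move=> hx.
have [_ [[i _ <-] hi]] : range (fun i : int => shift_by i bi_thue_morse) `&`
    [set y : full_shift | forall j : nat, (j < K)%N -> y (Posz j) = x (Posz j)] !=set0.
  apply: hx; elim: K => [|K IH]; first by apply: filterS filterT.
  have hK : nbhs x [set y : full_shift | y (Posz K) = x (Posz K)].
    by apply: (@proj_continuous _ _ (Posz K) x [set x (Posz K)]); exact: discrete_set1.
  apply: filterS2 IH hK => y h1 h2 j; rewrite ltnS leq_eqVlt => /orP[/eqP -> //|].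
  exact: h1.
have [a ha] := bi_thue_morse_factor K i.
by exists a => j jK; rewrite -hi // -ha.
Qed.

(** * Correlations along a sequence and their sums over dyadic blocks *)

Section Correlations.
Variable R : realType.

Lemma letter_addb (b c : bool) : letter (b (+) c) = letter b * letter c :> R.
Proof. exact: signr_addb. Qed.

Lemma letterN (b : bool) : letter (~~ b) = - letter b :> R.
Proof. exact: signrN. Qed.

Lemma normr_letter (b : bool) : `|letter b| = 1 :> R.
Proof. exact: normr_sign. Qed.

(** The sequence [s] will be [t] itself or the nonnegative half of a point of the hull. *)
Definition correlation k (m : 'I_k -> nat) (s : nat -> bool) (j : nat) : R :=
  letter (s j) * \prod_(i < k) letter (s (j + m i)%N).

Lemma normr_correlation k (m : 'I_k -> nat) s j : `|correlation m s j| = 1.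
Proof.
rewrite normrM normr_letter mul1r normr_prod big1 // => i _.
exact: normr_letter.
Qed.

Lemma sum_almost_eq (u v : nat -> R) (Q P : nat) :
  (forall j, `|u j| <= 1) -> (forall j, `|v j| <= 1) ->
  (forall j, (j < Q)%N -> u j = v j) ->
  `|\sum_(j < P) u j - \sum_(j < P) v j| <= 2 * (P - Q)%:R.
Proof.
move=> u1 v1 uv; elim: P => [|P IH]; first by rewrite !big_ord0 subrr normr0 mulr0.
rewrite !big_ord_recr /= opprD addrACA.
have [PQ|QP] := ltnP P Q.
  rewrite uv // subrr addr0 (le_trans IH) // ler_pM2l // ler_nat; lia.
rewrite subSn // -[(P - Q).+1%:R]natr1 mulrDr mulr1 (le_trans (ler_normD _ _)) // lerD //.
rewrite (le_trans (ler_normB _ _)) //; have := u1 P; have := v1 P; lra.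
Qed.

(** Each unit move of the window drops one term and gains one, at a cost of at most 2. *)
Lemma window_shift (u : nat -> R) (N a c : nat) : (forall j, `|u j| <= 1) ->
  `|\sum_(j < N) u (a + c + j)%N - \sum_(j < N) u (a + j)%N| <= 2 * c%:R.
Proof.
move=> u1; elim: c => [|c IH]; first by rewrite addn0 subrr normr0 mulr0.
have e : \sum_(j < N) u (a + c + j)%N + u (a + c + N)%N =
    u (a + c)%N + \sum_(j < N) u (a + c.+1 + j)%N.
  transitivity (\sum_(j < N.+1) u (a + c + j)%N); first by rewrite big_ord_recr.
  rewrite big_ord_recl /= addn0; congr (_ + _).
  by apply: eq_bigr => j _; rewrite /= /bump /= add1n !addnS addSn.
have -> : \sum_(j < N) u (a + c.+1 + j)%N =
    \sum_(j < N) u (a + c + j)%N + (u (a + c + N)%N - u (a + c)%N) by lra.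
rewrite addrAC -[c.+1%:R]natr1 mulrDr mulr1 (le_trans (ler_normD _ _)) // lerD //.
rewrite (le_trans (ler_normB _ _)) //.
have := u1 (a + c + N)%N; have := u1 (a + c)%N; lra.
Qed.

Section BlockSums.
Variables (k : nat) (m : 'I_k -> nat).
Notation F := (correlation m thue_morse).
Notation M := (\max_i m i)%N.

Definition block_sum (p a : nat) : R := \sum_(j < 2 ^ p) F (a * 2 ^ p + j)%N.

(** Except for the last [M] values of [j], all [k.+1] points lie in block [a], and each contributes
    the sign [t_a]. *)
Lemma block_sum_sign (p a : nat) :
  `|block_sum p a - letter (thue_morse a) ^+ k.+1 * block_sum p 0|
    <= 2 * M%:R.
Proof.
rewrite /block_sum mulr_sumr.
pose s := letter (thue_morse a) ^+ k.+1 : R.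
apply: (le_trans (@sum_almost_eq (fun j => F (a * 2 ^ p + j)%N)
  (fun j => s * F (0 * 2 ^ p + j)%N) (2 ^ p - M) _ _ _ _)).
- by move=> j; rewrite normr_correlation.
- by move=> j; rewrite normrM /s normrX normr_letter expr1n mul1r normr_correlation.
- move=> j hj; rewrite /s /correlation mul0n add0n thue_morse_block; last by lia.
  rewrite letter_addb exprS -!mulrA; congr (_ * _); rewrite mulrCA; congr (_ * _).
  have -> : letter (thue_morse a) ^+ k =
      \prod_(i < k) letter (thue_morse a) :> R by rewrite prodr_const card_ord.
  rewrite -big_split; apply: eq_bigr => i _ /=.
  rewrite -addnA thue_morse_block ?letter_addb //.
  have := @leq_bigmax _ (fun i => m i) i; lia.
- rewrite ler_pM2l // ler_nat; lia.
Qed.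

Lemma block_sumS (p a : nat) :
  block_sum p.+1 a = block_sum p a.*2 + block_sum p a.*2.+1.
Proof.
rewrite /block_sum.
have -> : (2 ^ p.+1 = 2 ^ p + 2 ^ p)%N by rewrite expnS mul2n addnn.
rewrite big_split_ord; congr (_ + _); apply: eq_bigr => j _ /=; congr F; lia.
Qed.

(* If the number [k.+1] of points is even, the sign in [block_sum_sign] is 1; if
   it is odd, the two halves of a block of length [2 ^ p.+1] nearly cancel. *)
Lemma block_sum_almost_const (p a : nat) :
  `|block_sum p.+1 a - block_sum p.+1 0| <= 8 * M%:R.
Proof.
have M0 : 0 <= M%:R :> R by [].
have [ko|ke] := boolP (odd k.+1).
  have small b : `|block_sum p.+1 b| <= 4 * M%:R.
    have h0 := block_sum_sign p b.*2; have h1 := block_sum_sign p b.*2.+1.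
    rewrite block_sumS; move: h0 h1.
    rewrite thue_morse_double thue_morse_doubleS letterN exprNn -signr_odd ko.
    rewrite expr1 mulN1r mulNr opprK !ler_norml; lra.
  rewrite (le_trans (ler_normB _ _)) //.
  have := small a; have := small 0%N; lra.
have := block_sum_sign p.+1 a.
rewrite /letter -exprM mulnC exprM -signr_odd (negbTE ke) expr0 expr1n mul1r.
lra.
Qed.

Lemma window_sum_aligned (p b q : nat) :
  \sum_(j < q * 2 ^ p) F (b * 2 ^ p + j)%N = \sum_(i < q) block_sum p (b + i).
Proof.
elim: q => [|q IH]; first by rewrite !big_ord0.
rewrite mulSn addnC big_split_ord big_ord_recr /= IH; congr (_ + _).
by apply: eq_bigr => j _; congr F; lia.
Qed.

(** Rounding [a] down to a multiple of [2 ^ p.+1] moves the window by less than one block; the [q]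
    aligned blocks then cost [8 * M] each. *)
Lemma window_sum (p a q : nat) :
  `|\sum_(j < q * 2 ^ p.+1) F (a + j)%N - q%:R * block_sum p.+1 0|
    <= q%:R * (8 * M%:R) + 2 * (2 ^ p.+1)%:R.
Proof.
set P := (2 ^ p.+1)%N; have P0 : (0 < P)%N by rewrite expn_gt0.
have F1 j : `|F j| <= 1 by rewrite normr_correlation.
rewrite {1}(divn_eq a P) -(subrKA (\sum_(j < q * P) F (a %/ P * P + j)%N)).
rewrite addrC (le_trans (ler_normD _ _)) // lerD //; last first.
  rewrite (le_trans (window_shift _ _ _ F1)) // ler_pM2l // ler_nat.
  by rewrite ltnW // ltn_pmod.
rewrite window_sum_aligned -[q in q%:R * block_sum _ _]card_ord mulr_natl.
rewrite -sumr_const -sumrB (le_trans (ler_norm_sum _ _ _)) //.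
rewrite -[q in leRHS]card_ord mulr_natl -sumr_const ler_sum // => i _.
exact: block_sum_almost_const.
Qed.

End BlockSums.

(** From the base [2N], point [i] gives [(-1) ^ r_i] times [t] at [N + m_i]; from [2N + 1] it gives
    [(-1) ^ (r_i + 1)] times [t] at [N + m_i + r_i]. The odd base point adds one more sign, whence
    [(-1) ^ k.+1]. *)
Lemma block_sum_rec k (m r : 'I_k -> nat) (p : nat) :
  (forall i, r i = 0%N \/ r i = 1%N) ->
  block_sum (fun i => (2 * m i + r i)%N) p.+1 0 =
  (-1) ^+ (\sum_i r i)%N *
    (block_sum m p 0 + (-1) ^+ k.+1 * block_sum (fun i => (m i + r i)%N) p 0).
Proof.
move=> hr; rewrite /block_sum expnS mulnC.
(* The identity holds for any number [N] of pairs [2j, 2j + 1], so the power of 2 is generalised. *)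
elim: (2 ^ p)%N => [|N IH]; first by rewrite !big_ord0 mulr0 addr0 mulr0.
rewrite mulSn addnC addn2 !big_ord_recr /= IH !mul0n !add0n muln2.
suff [-> ->] : correlation (fun i => (2 * m i + r i)%N) thue_morse N.*2 =
      (-1) ^+ (\sum_i r i)%N * correlation m thue_morse N /\
    correlation (fun i => (2 * m i + r i)%N) thue_morse N.*2.+1 =
      (-1) ^+ (\sum_i r i)%N * (-1) ^+ k.+1 *
        correlation (fun i => (m i + r i)%N) thue_morse N by ring.
rewrite /correlation thue_morse_double thue_morse_doubleS letterN exprS -prodrXr.
have -> : (-1) ^+ k = \prod_(i < k) -1 :> R by rewrite prodr_const card_ord.
split.
  rewrite mulrCA -big_split; congr (_ * _); apply: eq_bigr => i _ /=.
  have [->|->] := hr i.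
    by rewrite expr0 mul1r addn0 mul2n -doubleD thue_morse_double.
  by rewrite expr1 mulN1r addn1 mul2n addnS -doubleD thue_morse_doubleS letterN.
have -> : \prod_(i < k) letter (thue_morse (N.*2.+1 + (2 * m i + r i))) =
    \prod_(i < k) (-1) ^+ r i * \prod_(i < k) -1 *
    \prod_(i < k) letter (thue_morse (N + (m i + r i))) :> R.
  rewrite -!big_split; apply: eq_bigr => i _ /=.
  have [->|->] := hr i.
    by rewrite mul1r mulN1r !addn0 mul2n addSn -doubleD thue_morse_doubleS letterN.
  by rewrite mulrNN !mul1r !addn1 mul2n addnS addSn -doubleD -doubleS
    thue_morse_double addnS.
by ring.
Qed.

End Correlations.

(** Archimedean form of a limit: an error bounded uniformly in [q] vanishes after division by
    [q]. *)
Lemma natmul_bounded_le0 (R : realType) (c d : R) :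
  (forall q : nat, q%:R * d <= c) -> d <= 0.
Proof.
move=> h; rewrite leNgt; apply/negP => d0.
have := h (Num.bound `|c / d|); rewrite -ler_pdivlMr // leNgt => /negP; apply.
exact: le_lt_trans (ler_norm _) (archi_boundP (normr_ge0 _)).
Qed.

(** * Measurability of the shift and of the hull *)

Lemma shift_by_continuous (i : int) : continuous (shift_by i).
Proof.
move=> x; apply/cvg_sup => j.
apply: (@continuous_comp_initial _ _ _ (fun y : full_shift => y j) (shift_by i)).
exact: (@proj_continuous _ _ (j + i)).
Qed.

Lemma measurable_open_full_shift (A : set borel_full_shift) :
  open (A : set full_shift) -> measurable A.
Proof. exact: sub_sigma_algebra. Qed.

Lemma measurable_shift_by (i : int) :
  measurable_fun [set: borel_full_shift] (shift_by i : _ -> borel_full_shift).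
Proof.
apply: (@measurability _ _ borel_full_shift borel_full_shift setT (shift_by i) (@open full_shift)) => // _ [A oA <-].
rewrite setTI; apply: measurable_open_full_shift.
by apply: open_comp => // x _; exact: shift_by_continuous.
Qed.

Lemma measurable_TM_hull : measurable (TM_hull : set borel_full_shift).
Proof.
rewrite -[X in measurable X]setCK; apply: measurableC.
apply: measurable_open_full_shift; apply: closed_openC; exact: closed_closure.
Qed.

(** * Integration against the invariant measure *)

Section InvariantMeasure.
Variables (R : realType) (mu : probability borel_full_shift R).

Lemma measurable_letter_coordinate (l : int) :
  measurable_fun [set: borel_full_shift]
    (fun x : borel_full_shift => letter (x l) : R).
Proof.
apply: (measurableT_comp (f := letter)) => //.
apply: (measurable_fun_bool true); rewrite setTI.
apply: measurable_open_full_shift.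
apply: (@open_comp full_shift bool (fun x => x l) [set true]).
  by move=> x _; exact: proj_continuous.
exact: discrete_open.
Qed.

Definition hull_correlation k (m : 'I_k -> nat) (j : nat)
    (x : borel_full_shift) : R :=
  correlation R m (fun l => x (Posz l)) j.

Lemma measurable_hull_correlation k (m : 'I_k -> nat) j D :
  measurable_fun D (hull_correlation m j).
Proof.
apply: measurable_funTS; apply: measurable_funM.
  exact: measurable_letter_coordinate.
by apply: measurable_prod => i _; exact: measurable_letter_coordinate.
Qed.

Lemma bounded_integrable (f : borel_full_shift -> R) (C : R) D : measurable D ->
  measurable_fun D f -> (forall x, D x -> `|f x| <= C) ->
  mu.-integrable D (EFin \o f).
Proof.
move=> mD mf fC; apply: measurable_bounded_integrable => //.
  by rewrite (le_lt_trans (probability_le1 _ _)) // ltry.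
exists C; split; first exact: num_real.
by move=> y Cy x Dx; exact: le_trans (fC _ Dx) (ltW Cy).
Qed.

Lemma integrable_hull_correlation k (m : 'I_k -> nat) j D : measurable D ->
  mu.-integrable D (EFin \o hull_correlation m j).
Proof.
move=> mD; apply: (@bounded_integrable _ 1) => //.
  exact: measurable_hull_correlation.
by move=> x _; rewrite normr_correlation.
Qed.

Hypothesis hmu : TM_invariant mu.

(** The complement of the hull is null; this lets the change of variables under the shift take place
    on the full shift. *)
Lemma integral_hull (f : borel_full_shift -> R) :
  mu.-integrable setT (EFin \o f) ->
  \int[mu]_(x in TM_hull) f x = \int[mu]_x f x.
Proof.
move=> fi; have mH := measurable_TM_hull.
rewrite /Rintegral (negligible_integral (N := ~` (TM_hull : set borel_full_shift)) _ _ fi) //.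
- by rewrite setTD setCK.
- exact: measurableC.
- transitivity (1 - mu TM_hull)%E; first exact: probability_setC.
  by rewrite hmu.1 subee.
Qed.

Lemma integral_hull_cst (c : R) : \int[mu]_(_ in TM_hull) c = c.
Proof.
have mH := measurable_TM_hull; rewrite Rintegral_cst //.
transitivity (c * 1); last exact: mulr1.
by congr (c * _); exact: (congr1 fine hmu.1).
Qed.

Lemma integral_hull_correlation k (m : 'I_k -> nat) j :
  \int[mu]_(x in TM_hull) hull_correlation m j x = eta mu m.
Proof.
elim: j => [|j <-]; first by [].
rewrite !integral_hull; try exact: integrable_hull_correlation.
have e : hull_correlation m j.+1 = hull_correlation m j \o shift_by 1.
  apply/funext => x; rewrite /hull_correlation /correlation /shift_by /=.
  congr (letter (x _) * _); first by lia.
  by apply: eq_bigr => i _; congr (letter (x _)); lia.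
(* Change of variables to the image of [mu] under the shift, which by invariance agrees with [mu] on
   measurable sets. *)
congr fine; transitivity
  (\int[pushforward mu (shift_by 1 : _ -> borel_full_shift)]_x
     (hull_correlation m j x)%:E)%E.
  rewrite integral_pushforward //.
  - by rewrite e.
  - exact: measurable_shift_by.
  - by apply/measurable_EFinP; exact: measurable_hull_correlation.
  - by have := integrable_hull_correlation m j.+1 measurableT; rewrite e.
apply: eq_measure_integral => [|mS A mA _]; first exact: measurable_shift_by.
exact: hmu.2.
Qed.

Lemma integral_hull_window k (m : 'I_k -> nat) (N : nat) :
  \int[mu]_(x in TM_hull) (\sum_(j < N) hull_correlation m j x) =
    N%:R * eta mu m.
Proof.
have mH := measurable_TM_hull.
elim: N => [|N IH].
  under eq_Rintegral do rewrite big_ord0.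
  by rewrite integral_hull_cst mul0r.
under eq_Rintegral do rewrite big_ord_recr.
rewrite RintegralD //=; last exact: integrable_hull_correlation.
  by rewrite IH integral_hull_correlation -natr1 mulrDl mul1r.
have -> : EFin \o (fun x => \sum_(j < N) hull_correlation m j x) =
    (fun x => \sum_(j < N) (hull_correlation m j x)%:E)%E.
  by apply/funext => x /=; rewrite sumEFin.
by apply: integrable_sum => // j _; exact: integrable_hull_correlation.
Qed.

Lemma eta_block_sum k (m : 'I_k -> nat) (p : nat) :
  `|(2 ^ p.+1)%:R * eta mu m - block_sum R m p.+1 0|
    <= 8 * (\max_i m i)%:R.
Proof.
have mH := measurable_TM_hull.
(* Here [q] counts blocks: dividing by it removes the rounding term [2 * 2 ^ p.+1] of
   [window_sum]. *)
rewrite -subr_le0; apply: (@natmul_bounded_le0 _ (2 * (2 ^ p.+1)%:R)) => q.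
rewrite mulrBr lerBlDl -[q%:R in leLHS]ger0_norm // -normrM mulrBr mulrA.
rewrite -[q%:R * (2 ^ p.+1)%:R]natrM.
set N := (q * 2 ^ p.+1)%N; set B := q%:R * block_sum R m p.+1 0.
set C := leRHS; set g := fun x => \sum_(j < N) hull_correlation m j x.
have mg : measurable_fun (TM_hull : set borel_full_shift) (fun x => g x - B).
  apply: measurable_funB => //; apply: measurable_sum => j.
  exact: measurable_hull_correlation.
have gC x : TM_hull x -> `|g x - B| <= C.
  (* This length covers every coordinate [j + m i] with [j < N]. *)
  move=> hx; have [a ha] := TM_hull_factor (N + \max_i m i).+1 hx.
  have -> : g x = \sum_(j < N) correlation R m thue_morse (a + j).
    apply: eq_bigr => j _; rewrite /hull_correlation /correlation.
    have jN := ltn_ord j.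
    rewrite ha; last by lia.
    congr (_ * _); apply: eq_bigr => i _; rewrite ha ?addnA //.
    have := @leq_bigmax _ m i; lia.
  exact: window_sum.
have iB : mu.-integrable TM_hull (EFin \o fun=> B).
  exact: (@bounded_integrable _ `|B|).
have ig : mu.-integrable TM_hull (EFin \o g).
  apply: (@bounded_integrable _ (C + `|B|)) => //.
    by apply: measurable_sum => j; exact: measurable_hull_correlation.
  move=> x hx; rewrite -[g x](subrK B) (le_trans (ler_normD _ _)) // lerD2r.
  exact: gC.
have igB : mu.-integrable TM_hull (EFin \o fun x => g x - B).
  exact: (@bounded_integrable _ C).
have -> : N%:R * eta mu m - B = \int[mu]_(x in TM_hull) (g x - B).
  by rewrite RintegralB // integral_hull_window integral_hull_cst.
(* The hull has mass 1, so the pointwise bound [C] passes to the integral. *)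
rewrite (le_trans (le_normr_Rintegral _ igB)) //.
rewrite -[C in leRHS]integral_hull_cst.
apply: le_Rintegral => //; first exact: integrable_norm.
exact: (@bounded_integrable _ `|C|).
Qed.

End InvariantMeasure.

(** * Transfer of the recursion from block sums to [eta] *)

Theorem proposition4p1 (R : realType)
    (mu : probability borel_full_shift R) (hmu : TM_invariant mu)
    (n : nat) (hn : (2 <= n)%N)
    (r : 'I_n.-1 -> nat) (hr : forall i, r i = 0%N \/ r i = 1%N)
    (m : 'I_n.-1 -> nat) :
  eta mu (fun i => (2 * m i + r i)%N) =
  (-1) ^+ (\sum_i r i)%N / 2 *
    (eta mu m + (-1) ^+ n * eta mu (fun i => (m i + r i)%N)).
Proof.
case: n hn r hr m => [//|k] hn /= r hr m.
set m2 := fun i => (2 * m i + r i)%N; set m1 := fun i => (m i + r i)%N.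
set s := (-1) ^+ (\sum_i r i)%N; set e := (-1) ^+ k.+1.
have s1 : `|s| = 1 :> R by rewrite normrX normrN1 expr1n.
have e1 : `|e| = 1 :> R by rewrite normrX normrN1 expr1n.
suff : eta mu m2 * 2 - s * (eta mu m + e * eta mu m1) = 0 by lra.
set d := LHS; apply/normr0_eq0/eqP; rewrite eq_le normr_ge0 andbT.
pose K (m' : 'I_k -> nat) : R := 8 * (\max_i m' i)%:R.
(* Since [q <= 2 ^ q.+1], it is enough to bound [2 ^ q.+1] times the defect [d] uniformly in [q]. *)
apply: (@natmul_bounded_le0 _ (K m2 + (K m + K m1))) => q.
have P0 : 0 <= (2 ^ q.+1)%:R :> R by [].
have qP : q%:R <= (2 ^ q.+1)%:R :> R.
  by rewrite ler_nat ltnW // (ltn_trans (ltnSn q)) // ltn_expl.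
rewrite (le_trans (ler_wpM2r (normr_ge0 d) qP)) //.
rewrite -[(2 ^ q.+1)%:R]ger0_norm // -normrM.
have h2 := eta_block_sum hmu m2 q.+1; have h0 := eta_block_sum hmu m q.
have h1 := eta_block_sum hmu m1 q.
(* By [block_sum_rec] the inserted block sums cancel, so only three errors of [eta_block_sum]
   remain. *)
have -> : (2 ^ q.+1)%:R * d =
    (((2 ^ q.+2)%:R * eta mu m2 - block_sum R m2 q.+2 0)) -
    s * (((2 ^ q.+1)%:R * eta mu m - block_sum R m q.+1 0) +
         e * ((2 ^ q.+1)%:R * eta mu m1 - block_sum R m1 q.+1 0)).
  rewrite block_sum_rec // -/s -/e [in (2 ^ q.+2)%N]expnS natrM /d; ring.
rewrite (le_trans (ler_normB _ _)) // lerD // normrM s1 mul1r.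
by rewrite (le_trans (ler_normD _ _)) // lerD // normrM e1 mul1r.
Qed.
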